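(* Let $n\ge 2$, and let $\iota : C_n \to C_{n^2}$ denote the injection sending a generator $t$ of $C_n$ to $u^n$, where $u$ denotes a generator of $C_{n^2}$. Let $\partial : \iota_{\ast}C_n \to C_{n^2}$ be the crossed module induced by $\iota$ from the identity crossed module $C_n\to C_n$, and let $A_n$ denote the $C_n$-module which is the kernel of $\partial$. Then $H^3(C_n,A_n)$ is cyclic of order $n$ and has as generator the class of this induced crossed module $\partial$.
   Context: $C_k$ denotes the cyclic group of order $k$, written multiplicatively. A crossed module is a morphism of groups $\mu : M \to P$ together with a right action $(m,p)\mapsto m^p$ of $P$ on $M$ by automorphisms such that $\mu(m^p)=p^{-1}(\mu m)p$ and $n^{-1}mn = m^{\mu n}$ for all $m,n\in M$, $p\in P$. A morphism from $\mu:M\to P$ to $\nu:N\to Q$ is a pair of group morphisms $g:M\to N$, $f:P\to Q$ with $\nu g=f\mu$ and $g(m^p)=(gm)^{fp}$. A crossed $P$-module is a crossed module with codomain $P$; morphisms of crossed $P$-modules are the identity on $P$. The identity $P\to P$ with conjugation action is a crossed module. Given a crossed module $\mu:M\to P$ and a group morphism $\iota:P\to Q$, the induced crossed module is a crossed $Q$-module $\iota_{\ast}M\to Q$ together with a morphism of crossed modules $(\bar\iota,\iota)$ from $M\to P$ to $\iota_{\ast}M\to Q$, characterised by the universal property: for every crossed $Q$-module $\gamma:C\to Q$ and every morphism of crossed modules $(f,\iota)$ from $M\to P$ to $C\to Q$, there is a unique morphism of crossed $Q$-modules $g:\iota_{\ast}M\to C$ with $g\bar\iota=f$. For any crossed module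 $\mu:M\to P$, $\mathrm{Ker}\,\mu$ is a module over $\mathrm{Coker}\,\mu=P/\mu M$. In the claim, the cokernel of $\partial$ is cyclic of order $n$, generated by the image of $u$, and is identified with $C_n$ (the image of $u$ corresponding to the generator $t$); this gives the $C_n$-module structure on $A_n$. For a group $G$ and $G$-module $A$, elements of $H^3(G,A)$ correspond to equivalence classes of crossed sequences, i.e. exact sequences $0\to A\to M\xrightarrow{\mu}P\to G\to 1$ with $\mu$ a crossed module (inducing the given $G$-action on $A$), under the equivalence relation generated by morphisms of such sequences that are the identity on $A$ and $G$ and are morphisms of crossed modules in the middle. The class of a crossed module $\mu:M\to P$ is the element of $H^3(\mathrm{Coker}\,\mu,\mathrm{Ker}\,\mu)$ represented by $0\to\mathrm{Ker}\,\mu\to M\to P\to\mathrm{Coker}\,\mu\to 1$. *)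

(* Defs.v *)
From HB Require Import structures.
From mathcomp Require Import all_boot all_algebra.
From mathcomp Require Import boolp classical_sets functions cardinality.

Set Implicit Arguments.
Unset Strict Implicit.
Unset Printing Implicit Defensive.

Import GRing.Theory.

Local Open Scope ring_scope.

Record crossed_module (M P : groupType) := CrossedModule {
  xmap :> {multiplicative M -> P};
  xact : M -> P -> M;
  xact1 : forall m, xact m 1%g = m;
  xactM : forall m p q, xact m (p * q)%g = xact (xact m p) q;
  xactMg : forall m n p, xact (m * n)%g p = (xact m p * xact n p)%g;
  xmap_act : forall m p, xmap (xact m p) = (p^-1 * xmap m * p)%g;
  xpeiffer : forall m n, (n^-1 * m * n)%g = xact m (xmap n)
}.

Arguments xact {M P} c m p.

Definition xmod_morphism (M P N Q : groupType)
    (mu : crossed_module M P) (nu : crossed_module N Q)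
    (g : {multiplicative M -> N}) (f : {multiplicative P -> Q}) : Prop :=
  (forall m, nu (g m) = f (mu m)) /\
  (forall m p, g (xact mu m p) = xact nu (g m) (f p)).

Section IdentityCrossedModule.
Variable P : groupType.

Fact idfun_conj (m p : P) : idfun (m ^ p)%g = (p^-1 * idfun m * p)%g.
Proof. by rewrite /= conjgE mulgA. Qed.

Fact idfun_peiffer (m n : P) : (n^-1 * m * n)%g = (m ^ idfun n)%g.
Proof. by rewrite /= conjgE mulgA. Qed.

Definition xmod_id : crossed_module P P :=
  @CrossedModule P P idfun (fun m p => (m ^ p)%g) (@conjg1 P)
    (@conjgM P) (@conjMg P) idfun_conj idfun_peiffer.

End IdentityCrossedModule.

(** [nu : N -> Q], together with [ibar : M -> N], is the crossed [Q]-module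
    induced from [mu : M -> P] along [iota : P -> Q]. *)
Definition is_induced (M P N Q : groupType) (mu : crossed_module M P)
    (iota : {multiplicative P -> Q})
    (nu : crossed_module N Q) (ibar : {multiplicative M -> N}) : Prop :=
  xmod_morphism mu nu ibar iota /\
  forall (C : groupType) (gamma : crossed_module C Q)
         (f : {multiplicative M -> C}),
    xmod_morphism mu gamma f iota ->
    exists g : {multiplicative N -> C},
      [/\ xmod_morphism nu gamma g idfun,
          forall m, g (ibar m) = f m
        & forall g' : {multiplicative N -> C},
            xmod_morphism nu gamma g' idfun ->
            (forall m, g' (ibar m) = f m) -> g' =1 g].

(** [phi : P -> G] exhibits [G] as the cokernel of [mu : M -> P]. *)
Definition is_coker (M P G : groupType) (mu : crossed_module M P)
    (phi : {multiplicative P -> G}) : Prop :=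
  (forall g, exists p, phi p = g) /\
  (forall p, phi p = 1%g <-> exists m, p = mu m).

Record gmodule (G : groupType) (A : zmodType) := GModule {
  gact :> A -> G -> A;
  gact1 : forall a, gact a 1%g = a;
  gactM : forall a g h, gact a (g * h)%g = gact (gact a g) h;
  gactD : forall a b g, gact (a + b) g = gact a g + gact b g
}.

Fact subrACA (A : zmodType) (a b c d : A) :
  (a + b) - (c + d) = (a - c) + (b - d).
Proof. by rewrite opprD addrACA. Qed.

Section Cohomology.
Variables (G : groupType) (A : zmodType) (act : gmodule G A).

Lemma gact0 g : act 0 g = 0.
Proof. by apply: (addrI (act 0 g)); rewrite -gactD !addr0. Qed.

Lemma gactN a g : act (- a) g = - act a g.
Proof. by apply: (addrI (act a g)); rewrite -gactD !subrr gact0. Qed.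

(** Inhomogeneous cochains.  As [G] acts on the right, it acts through the last
    argument: these are, up to sign, the usual left-module formulas for the
    opposite group, with the arguments in reverse order. *)
Definition delta2 (b : G -> G -> A) (g h k : G) : A :=
  b h k - b (g * h)%g k + b g (h * k)%g - act (b g h) k.

Definition delta3 (c : G -> G -> G -> A) (g h k l : G) : A :=
  c h k l - c (g * h)%g k l + c g (h * k)%g l - c g h (k * l)%g
  + act (c g h k) l.

Definition cocycle3 : {pred G -> G -> G -> A} :=
  [pred c | `[< forall g h k l, delta3 c g h k l = 0 >]].

Lemma delta3B c d g h k l :
  delta3 (c - d) g h k l = delta3 c g h k l - delta3 d g h k l.
Proof. by rewrite /delta3 !fctE gactD gactN ![in RHS]subrACA !opprD. Qed.

Fact cocycle3_zmod_closed : zmod_closed cocycle3.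
Proof.
split=> [|c d /asboolP cP /asboolP dP]; apply/asboolP => g h k l.
  have z3 x y z : (0 : G -> G -> G -> A) x y z = 0 by [].
  by rewrite /delta3 !z3 gact0 !(subr0, addr0).
by rewrite delta3B cP dP subr0.
Qed.
HB.instance Definition _ :=
  GRing.isZmodClosed.Build (G -> G -> G -> A) cocycle3 cocycle3_zmod_closed.

Definition Z3 : Type := {c : G -> G -> G -> A | c \in cocycle3}.
HB.instance Definition _ := [isSub of Z3 for sval].
HB.instance Definition _ := [Choice of Z3 by <:].
HB.instance Definition _ := [SubChoice_isSubZmodule of Z3 by <:].

Definition coboundary3 : {pred Z3} :=
  [pred c : Z3 | `[< exists b, forall g h k, val c g h k = delta2 b g h k >]].

Lemma delta2B b b' g h k :
  delta2 (b - b') g h k = delta2 b g h k - delta2 b' g h k.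
Proof.
by rewrite /delta2 !fctE gactD gactN ![in RHS]subrACA !opprD.
Qed.

Fact coboundary3_zmod_closed : zmod_closed coboundary3.
Proof.
split=> [|c d /asboolP[b bP] /asboolP[b' b'P]]; apply/asboolP.
  have z2 x y : (0 : G -> G -> A) x y = 0 by [].
  by exists 0 => g h k; rewrite /delta2 !z2 gact0 !(subr0, addr0).
by exists (b - b') => g h k; rewrite delta2B -bP -b'P.
Qed.
HB.instance Definition _ :=
  GRing.isZmodClosed.Build Z3 coboundary3 coboundary3_zmod_closed.

Definition H3 : zmodType := Quotient.quot coboundary3.

Definition H3_class (c : Z3) : H3 := \pi_(Quotient.quot coboundary3)%qT c.

Lemma H3_classP (c d : Z3) :
  (exists b, forall g h k, val c g h k = val d g h k + delta2 b g h k) ->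
  H3_class c = H3_class d.
Proof.
case=> b bP; apply/eqP; rewrite -Quotient.idealrBE; apply/asboolP.
by exists b => g h k; rewrite raddfB /= !fctE bP addrC addKr.
Qed.

End Cohomology.

Record crossed_sequence (G : groupType) (A : zmodType) (act : gmodule G A) :=
  CrossedSequence {
    cs_M : groupType;
    cs_P : groupType;
    cs_mu : crossed_module cs_M cs_P;
    cs_in : A -> cs_M;
    cs_pr : {multiplicative cs_P -> G};
    cs_inD : forall a b, cs_in (a + b) = (cs_in a * cs_in b)%g;
    cs_in_inj : injective cs_in;
    cs_exactM : forall m, cs_mu m = 1%g <-> exists a, m = cs_in a;
    cs_coker : is_coker cs_mu cs_pr;
    cs_act : forall a p, cs_in (act a (cs_pr p)) = xact cs_mu (cs_in a) p
  }.

(** Morphisms that are the identity on [A] and [G]; they generate the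
    equivalence relation on crossed sequences. *)
Definition cs_morphism (G : groupType) (A : zmodType) (act : gmodule G A)
    (E F : crossed_sequence act)
    (g : {multiplicative cs_M E -> cs_M F})
    (f : {multiplicative cs_P E -> cs_P F}) : Prop :=
  [/\ xmod_morphism (cs_mu E) (cs_mu F) g f,
      forall a, g (cs_in E a) = cs_in F a
    & forall p, cs_pr F (f p) = cs_pr E p].

Lemma mulhom1 (M N : groupType) (f : {multiplicative M -> N}) : f 1%g = 1%g.
Proof.
by apply: (mulgI (f 1%g)); rewrite -gmulfM !mulg1.
Qed.

Lemma mulhomV (M N : groupType) (f : {multiplicative M -> N}) x :
  f x^-1%g = (f x)^-1%g.
Proof.
apply: (mulgI (f x)).
by rewrite -gmulfM !mulgV mulhom1.
Qed.

Section CrossedModuleTheory.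
Variables (M P : groupType) (mu : crossed_module M P).

Lemma xact1g p : xact mu 1%g p = 1%g.
Proof.
by apply: (mulgI (xact mu 1%g p)); rewrite -xactMg !mulg1.
Qed.

Lemma xactVg m p : xact mu m^-1%g p = (xact mu m p)^-1%g.
Proof.
apply: (mulgI (xact mu m p)).
by rewrite -xactMg !mulgV xact1g.
Qed.

Lemma xpeifferC m n : (m * n = n * xact mu m (mu n))%g.
Proof. by rewrite -xpeiffer !mulgA mulgV mul1g. Qed.

Lemma xker_central m n : mu m = 1%g -> (n * m = m * n)%g.
Proof. by move=> m1; rewrite [LHS]xpeifferC m1 xact1. Qed.

End CrossedModuleTheory.

Section CrossedSequenceClass.
Variables (G : groupType) (A : zmodType) (act : gmodule G A).
Implicit Types E F : crossed_sequence act.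

(** The three-cocycle of a crossed sequence: [s] is a section of
    [P -> G], [f g h] in [M] measures the failure of [s] to be multiplicative,
    and [c g h k] in [A] the failure of [f] to satisfy the (twisted) two-cocycle
    identity. *)
Definition factor_system E (s : G -> cs_P E) (f : G -> G -> cs_M E)
    (c : G -> G -> G -> A) : Prop :=
  [/\ forall g, cs_pr E (s g) = g,
      forall g h, (s g * s h = s (g * h)%g * cs_mu E (f g h))%g
    & forall g h k,
        (f g (h * k) * f h k =
         f (g * h) k * xact (cs_mu E) (f g h) (s k) * cs_in E (c g h k))%g].

Section Sequence.
Variable E : crossed_sequence act.
Local Notation mu := (cs_mu E).
Local Notation inA := (cs_in E).

Lemma cs_in_ker a : mu (inA a) = 1%g.
Proof. by apply/cs_exactM; exists a. Qed.

Lemma cs_inC a m : (inA a * m = m * inA a)%g.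
Proof. by rewrite [RHS](xker_central _ (cs_in_ker a)). Qed.

Lemma cs_section_ex g : exists p, cs_pr E p = g.
Proof. exact: (cs_coker E).1. Qed.

Definition cs_section g : cs_P E := sval (cid (cs_section_ex g)).

Lemma cs_sectionK g : cs_pr E (cs_section g) = g.
Proof. exact: (svalP (cid (cs_section_ex g))). Qed.

Lemma cs_lift_ex p q : cs_pr E p = cs_pr E q -> exists m, p = (q * mu m)%g.
Proof.
move=> pq; have /((cs_coker E).2)[m mE] : cs_pr E (q^-1 * p)%g = 1%g.
  by rewrite gmulfM mulhomV pq mulVg.
by exists m; rewrite -mE mulVKg.
Qed.

Lemma cs_factor_ex g h : exists m,
  (cs_section g * cs_section h = cs_section (g * h)%g * mu m)%g.
Proof. by apply: cs_lift_ex; rewrite gmulfM !cs_sectionK. Qed.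

Definition cs_factor g h : cs_M E := sval (cid (cs_factor_ex g h)).

Lemma cs_factorE g h :
  (cs_section g * cs_section h = cs_section (g * h)%g * mu (cs_factor g h))%g.
Proof. exact: (svalP (cid (cs_factor_ex g h))). Qed.

Lemma cs_diff_ex m n : mu m = mu n -> exists a, m = (n * inA a)%g.
Proof.
move=> mn; have /cs_exactM[a aE] : mu (n^-1 * m)%g = 1%g.
  by rewrite gmulfM mulhomV mn mulVg.
by exists a; rewrite -aE mulVKg.
Qed.

Lemma cs_cocycle_ex g h k : exists a,
  (cs_factor g (h * k) * cs_factor h k =
   cs_factor (g * h) k * xact mu (cs_factor g h) (cs_section k) * inA a)%g.
Proof.
apply: cs_diff_ex; rewrite !gmulfM xmap_act.
apply: (mulgI (cs_section (g * (h * k)))%g).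
rewrite [LHS]mulgA -cs_factorE -mulgA -cs_factorE mulgA.
rewrite [X in _ = (cs_section X * _)%g]mulgA [RHS]mulgA -cs_factorE.
by rewrite -!mulgA mulVKg mulgA cs_factorE -!mulgA.
Qed.

Definition cs_cocycle g h k : A := sval (cid (cs_cocycle_ex g h k)).

Lemma cs_factor_systemP : factor_system cs_section cs_factor cs_cocycle.
Proof.
split=> [g|g h|g h k]; [exact: cs_sectionK|exact: cs_factorE|].
exact: (svalP (cid (cs_cocycle_ex g h k))).
Qed.

Lemma factor_system_cocycle s f c :
  @factor_system E s f c -> c \in cocycle3 act.
Proof.
case=> sK fE cE; apply/asboolP => g h k l.
pose X := (f g (h * (k * l)) * f h (k * l) * f k l)%g.
pose Y := (f (g * h * k) l * xact mu (f (g * h) k) (s l)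
  * xact mu (f g h) (s k * s l))%g.
have X1 : X = (Y * inA (c (g * h)%g k l + c g h (k * l)%g))%g.
  rewrite /X cE -[LHS]mulgA cs_inC [LHS]mulgA.
  rewrite -[X in (X * _)%g]mulgA (xpeifferC mu _ (f k l)) -xactM -fE.
  rewrite [X in (X * _)%g]mulgA cE.
  rewrite -[X in (X * _)%g]mulgA (cs_inC (c _ k l)) [X in (X * _)%g]mulgA.
  by rewrite -[LHS]mulgA -cs_inD.
have X2 : X = (Y * inA (c g (h * k)%g l + act (c g h k) l + c h k l))%g.
  rewrite /X -[LHS]mulgA cE [in LHS](mulgA h).
  rewrite [LHS]mulgA [X in (X * _)%g]mulgA cE.
  rewrite -[X in (X * _)%g]mulgA cs_inC [X in (X * _)%g]mulgA.
  rewrite -[X in (X * _ * _)%g]mulgA -xactMg cE !xactMg -xactM -cs_act sK.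
  rewrite -[LHS]mulgA -cs_inD [(g * (h * k))%g]mulgA.
  rewrite [X in (X * _)%g]mulgA [X in (X * _ * _)%g]mulgA -[LHS]mulgA -cs_inD.
  by rewrite addrCA addrA.
move: X1; rewrite X2 => /mulgI /cs_in_inj H.
rewrite /delta3 [LHS](ACl (3*5*1*2*4)) /= -addrA -opprD H.
exact: subrr.
Qed.

Lemma factor_system_unique s f c s' f' c' :
    @factor_system E s f c -> @factor_system E s' f' c' ->
  exists b, forall g h k, c' g h k = c g h k + delta2 act b g h k.
Proof.
case=> sK fE cE [s'K f'E c'E].
have /choice[w wE] : forall g, exists m, s' g = (s g * mu m)%g.
  by move=> g; apply: cs_lift_ex; rewrite sK s'K.
pose f0 g h := ((w (g * h))^-1 * f g h * xact mu (w g) (s h) * w h)%g.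
have f0E g h : (s' g * s' h = s' (g * h) * mu (f0 g h))%g.
  rewrite !wE /f0 !gmulfM xmap_act mulhomV -[RHS]mulgA.
  rewrite -!mulgA mulVKg !mulgA -fE.
  by rewrite -!mulgA mulVKg.
have /choice[b bE] : forall x : G * G, exists a,
    f' x.1 x.2 = (f0 x.1 x.2 * inA a)%g.
  case=> g h /=; apply: cs_diff_ex; apply: (mulgI (s' (g * h)%g)).
  by rewrite -f'E f0E.
exists (fun g h => b (g, h)) => g h k; apply: (@cs_in_inj _ _ _ E).
have {bE}bE g1 h1 : f' g1 h1 = (f0 g1 h1 * inA (b (g1, h1)))%g.
  exact: (bE (g1, h1)).
pose Z := ((w (g * h * k))^-1 * f (g * h) k * xact mu (f g h) (s k)
   * xact mu (w g) (s h * s k) * xact mu (w h) (s k) * w k)%g.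
have f0M : (f0 g (h * k) * f0 h k = Z * inA (c g h k))%g.
  rewrite /f0 !mulgA mulgK -(mulgA (_ * f g _)%g) (xpeifferC mu _ (f h k)) -xactM -fE !mulgA.
  rewrite -(mulgA _^-1%g) cE /Z -!mulgA; do 3!congr (_ * _)%g.
  by rewrite cs_inC -!mulgA.
have f0J : (f0 (g * h) k * xact mu (f0 g h) (s' k) = Z)%g.
  rewrite wE xactM -xpeiffer /f0 !xactMg xactVg -xactM.
  by rewrite /Z -!mulgA !mulVKg.
move: Z f0M f0J => Z f0M f0J.
have := c'E g h k; rewrite !bE xactMg -cs_act s'K.
rewrite mulgA -(mulgA (f0 g _)) cs_inC mulgA f0M.
rewrite mulgA -(mulgA (f0 _ k)) cs_inC mulgA f0J -!mulgA -!cs_inD.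
move=> /mulgI /cs_in_inj ccE; congr inA; rewrite /delta2.
apply: (addrI (b ((g * h)%g, k) + act (b (g, h)) k)).
rewrite -[LHS]addrA -ccE !addrA [RHS](ACl (3*6*4*(1*5)*(2*7))) /=.
by rewrite !subrr !addr0.
Qed.

End Sequence.

(** This does not depend on the chosen factor system ([crossed_classE]), and
    is invariant under the equivalence of crossed sequences
    ([crossed_class_morphism]). *)
Definition crossed_class E : H3 act :=
  H3_class (Sub (cs_cocycle E)
    (factor_system_cocycle (cs_factor_systemP E)) : Z3 act).

Lemma crossed_classE E s f c (Ec : @factor_system E s f c) :
  crossed_class E = H3_class (Sub c (factor_system_cocycle Ec) : Z3 act).
Proof.
apply: H3_classP; exact: factor_system_unique Ec (cs_factor_systemP E).
Qed.

Lemma crossed_class_morphism E F g f :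
  @cs_morphism _ _ act E F g f -> crossed_class E = crossed_class F.
Proof.
case=> -[muM actM] inM prM.
have [sK fE cE] := cs_factor_systemP E.
have Fc : @factor_system F (fun x => f (cs_section E x))
    (fun x y => g (cs_factor E x y)) (cs_cocycle E).
  split=> [x|x y|x y z]; first by rewrite prM.
    by rewrite -gmulfM fE gmulfM muM.
  by rewrite -gmulfM cE !gmulfM inM actM.
rewrite (crossed_classE Fc) /crossed_class; congr H3_class; exact: val_inj.
Qed.

End CrossedSequenceClass.

Section Kernel.
Variables (M P : groupType) (mu : crossed_module M P).

(** The kernel of a crossed module is central, hence abelian; it is written
    additively. *)
Definition xker : Type := {m : M | mu m == 1%g}.
HB.instance Definition _ := [isSub of xker for sval].
HB.instance Definition _ := [Choice of xker by <:].

Implicit Types a b : xker.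

Lemma xkerP a : mu (val a) = 1%g. Proof. exact/eqP/(valP a). Qed.

Fact xker1_subproof : mu 1%g == 1%g. Proof. by rewrite mulhom1. Qed.
Fact xkerM_subproof a b : mu (val a * val b)%g == 1%g.
Proof. by rewrite gmulfM !xkerP mulg1. Qed.
Fact xkerV_subproof a : mu (val a)^-1%g == 1%g.
Proof. by rewrite mulhomV xkerP invg1. Qed.
Fact xkerJ_subproof a p : mu (xact mu (val a) p) == 1%g.
Proof. by rewrite xmap_act xkerP mulg1 mulVg. Qed.

Definition xker_zero : xker := exist _ 1%g xker1_subproof.
Definition xker_add a b : xker := exist _ (val a * val b)%g (xkerM_subproof a b).
Definition xker_opp a : xker := exist _ ((val a)^-1)%g (xkerV_subproof a).
Definition xker_act a p : xker := exist _ (xact mu (val a) p) (xkerJ_subproof a p).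

Fact xker_addA : associative xker_add.
Proof. by move=> a b c; apply: val_inj; rewrite /= mulgA. Qed.
Fact xker_addC : commutative xker_add.
Proof. by move=> a b; apply: val_inj; rewrite /= (xker_central _ (xkerP b)). Qed.
Fact xker_add0 : left_id xker_zero xker_add.
Proof. by move=> a; apply: val_inj; rewrite /= mul1g. Qed.
Fact xker_addN : left_inverse xker_zero xker_opp xker_add.
Proof. by move=> a; apply: val_inj; rewrite /= mulVg. Qed.
HB.instance Definition _ :=
  GRing.isZmodule.Build xker xker_addA xker_addC xker_add0 xker_addN.

Variables (G : groupType) (phi : {multiplicative P -> G}).
Hypothesis phi_coker : is_coker mu phi.

Definition coker_lift g : P := sval (cid (phi_coker.1 g)).

Lemma coker_liftK g : phi (coker_lift g) = g.
Proof. exact: (svalP (cid (phi_coker.1 g))). Qed.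

Lemma xker_act_coker a p q : phi p = phi q -> xker_act a p = xker_act a q.
Proof.
move=> pq; have /(phi_coker.2)[m mE] : phi (p * q^-1)%g = 1%g.
  by rewrite gmulfM mulhomV pq mulgV.
apply: val_inj; rewrite /= -(mulgVK q p) mE xactM -xpeiffer.
by rewrite -mulgA -(xker_central _ (xkerP a)) mulKg.
Qed.

(** The [G]-module structure on the kernel: [phi p] acts as [p]. *)
Definition xker_gact a g : xker := xker_act a (coker_lift g).

Fact xker_gactE a p : xker_gact a (phi p) = xker_act a p.
Proof. by apply: xker_act_coker; rewrite coker_liftK. Qed.

Fact xker_gact1 a : xker_gact a 1%g = a.
Proof.
by rewrite -(mulhom1 phi) xker_gactE; apply: val_inj; rewrite /= xact1.
Qed.

Fact xker_gactM a g h : xker_gact a (g * h)%g = xker_gact (xker_gact a g) h.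
Proof.
rewrite -[g]coker_liftK -[h]coker_liftK -gmulfM !xker_gactE.
by apply: val_inj; rewrite /= xactM.
Qed.

Fact xker_gactD a b g : xker_gact (a + b) g = xker_gact a g + xker_gact b g.
Proof. by apply: val_inj; rewrite /= xactMg. Qed.

Definition xker_module : gmodule G xker :=
  GModule xker_gact1 xker_gactM xker_gactD.

Fact xker_exact m : mu m = 1%g <-> exists a : xker, m = val a.
Proof.
split=> [/eqP m1|[a ->]]; last exact: xkerP.
by exists (exist _ m m1 : xker).
Qed.

Fact xker_gact_val a p : val (xker_module a (phi p)) = xact mu (val a) p.
Proof. by rewrite [xker_module a _]xker_gactE. Qed.

Definition xker_sequence : crossed_sequence xker_module :=
  @CrossedSequence G xker xker_module M P mu val phi (fun=> fun=> erefl)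
    val_inj xker_exact phi_coker xker_gact_val.

End Kernel.

Definition zmod_generator (V : zmodType) (x : V) : Prop :=
  forall y : V, exists k : int, y = x *~ k.

Definition zmod_cyclic (V : zmodType) : Prop := exists x : V, zmod_generator x.

(* Main.v *)
From HB Require Import structures.
Require Import Defs.
From mathcomp Require Import all_boot all_algebra all_fingroup cyclic.
From mathcomp Require Import boolp classical_sets functions cardinality.

Set Implicit Arguments.
Unset Strict Implicit.
Unset Printing Implicit Defensive.

Import GRing.Theory.

Local Open Scope ring_scope.

(** Write [P] for the cyclic group of order [n], with generator [t], and
    [Q] for the cyclic group of order [n^2], with generator [u].

    The induced crossed module is known explicitly ([induced_iso]): up to
    isomorphism it is the group of all functions [F : P -> P] under pointwise
    multiplication, with boundary [F |-> iota (\prod_x F x)], on which [q] in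
    [Q] acts by translation of the argument by [phi q].  The universal property
    gives a map from the induced crossed module [N] to this model, and its
    uniqueness clause is used twice: to see that [iota P] acts trivially on [N],
    so that [N] is commutative and a map back can be written down, and to see
    that going there and back is the identity of [N].

    Hence the kernel [A] of the boundary sits in an exact sequence of
    [P]-modules [0 -> A -> (P -> V) -> V -> 0], where [V] is [P] in additive
    notation with trivial action, [P -> V] is coinduced and the second map sums
    the values of a function.  The cohomology of the coinduced module vanishes in
    degrees 2 and 3 ([coind_H2], [coind_H3]), so [H^3(P, A)] is isomorphic to
    [H^2(P, V)], and as [P] is cyclic and [n] kills [V], the latter is identified
    with [V] by [b |-> \sum_g b g t] ([sum_coboundary], [cyclic_H2]).
    Concretely, a 3-cocycle [c] of [A] is [delta2 b] for some 2-cochain [b] of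
    [P -> V], and it corresponds to [\sum_g \sum_x b g t x]; this is the
    relation [connects].

    For the class of the crossed module no such [b] has to be sought: if
    [s], [f], [c] is a factor system then [c = delta2 f] by definition, as [N] is
    itself the coinduced module.  Since the boundary of [f g t] is
    [(s (g * t))^-1 * s g * s t], the product over [g] telescopes to
    [(s t)^n = u^n = iota t] ([factor_system_connects]).  So the class corresponds
    to [t], which generates [V]. *)

(** * Cyclic groups and abelian groups in additive notation *)

Lemma cyclic_index (G : finGroupType) (t g : G) : <[t]>%g = [set: G]%SET ->
  exists2 i, (i < #[t]%g)%N & g = (t ^+ i)%g.
Proof.
move=> t_gen; have /cyclePmin[i lti gE] : g \in <[t]>%g by rewrite t_gen inE.
by exists i.
Qed.

Lemma cyclic_comm (G : finGroupType) (t : G) : <[t]>%g = [set: G]%SET ->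
  forall x y : G, (x * y = y * x)%g.
Proof.
move=> t_gen x y; have [i _ ->] := cyclic_index x t_gen.
by have [j _ ->] := cyclic_index y t_gen; rewrite -!expgD addnC.
Qed.

Lemma mulhomX (M N : groupType) (f : {multiplicative M -> N}) x k :
  f (x ^+ k)%g = (f x ^+ k)%g.
Proof.
by elim: k => [|k IHk]; [exact: mulhom1 | rewrite !expgS gmulfM IHk].
Qed.

(** A commutative group in additive notation.  The proof of commutativity is a
    parameter of the type, from which the additive structure is found. *)
Definition additive_of (H : groupType) (HC : forall x y : H, (x * y = y * x)%g) :
  Type := H.

Section AdditiveOf.
Variables (H : groupType) (HC : forall x y : H, (x * y = y * x)%g).

HB.instance Definition _ := Choice.copy (additive_of HC) H.
HB.instance Definition _ := GRing.isZmodule.Build (additive_of HC)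
  (@mulgA H) HC (@mul1g H) (@mulVg H).

Lemma additive_ofMn (x : additive_of HC) k : x *+ k = (x ^+ k)%g :> H.
Proof.
elim: k => [|k IHk]; first by [].
by rewrite mulrS expgS -IHk.
Qed.
End AdditiveOf.

Lemma mulhom_sum (H H' : groupType) (HC : forall x y : H, (x * y = y * x)%g)
    (HC' : forall x y : H', (x * y = y * x)%g)
    (f : {multiplicative H -> H'}) (I : Type) (r : seq I)
    (F : I -> additive_of HC) :
  f (\sum_(i <- r) F i) = \sum_(i <- r) (f (F i) : additive_of HC').
Proof.
elim: r => [|i r IHr]; first by rewrite !big_nil; exact: mulhom1.
by rewrite !big_cons -IHr; exact: gmulfM.
Qed.

Lemma cyclic_card_eq (V : zmodType) (x : V) n : (0 < n)%N ->
    (forall y, exists k, y = x *+ k) ->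
    (forall k, x *+ k = 0 <-> (n %| k)%N) ->
  ([set: V]%classic #= `I_n)%card.
Proof.
move=> n0 x_gen x_ord.
have xM k : x *+ (k %% n) = x *+ k.
  rewrite [in RHS](divn_eq k n) mulrnDr.
  by have /x_ord -> := dvdn_mull (k %/ n)%N (dvdnn n); rewrite add0r.
have /choice[f fP] : forall y, exists k, (k < n)%N /\ y = x *+ k.
  move=> y; have [k ->] := x_gen y; exists (k %% n)%N.
  by rewrite ltn_mod xM.
have f_inj k l : (k < n)%N -> (l <= k)%N -> x *+ k = x *+ l -> k = l.
  move=> kn lk /eqP; rewrite -subr_eq0 -mulrnBr // => /eqP/x_ord.
  have kl : (k - l < n)%N by apply: leq_ltn_trans kn; rewrite leq_subr.
  by rewrite /dvdn modn_small // subn_eq0 => kl'; apply/eqP; rewrite eqn_leq kl'.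
apply/card_set_bijP; exists f; split.
- by move=> y _; have [] := fP y.
- move=> y z _ _ fyz; have [_ ->] := fP y; have [_ ->] := fP z.
  by rewrite fyz.
- move=> k kn; exists (x *+ k) => //; have [fn fE] := fP (x *+ k).
  have [kf|/ltnW fk] := leqP k (f (x *+ k)); first exact: f_inj.
  by apply/esym/f_inj.
Qed.

(** * Coinduced modules *)

Section Coinduced.
Variables (G : groupType) (V : zmodType).

(** The module coinduced from the trivial group: all functions [G -> V], with
    [G] acting on the right by left translation of the argument. *)
Definition coind_act (F : G -> V) (g : G) : G -> V := fun x => F (g * x)%g.

Fact coind_act1 F : coind_act F 1%g = F.
Proof. by apply/funext => x; rewrite /coind_act mul1g. Qed.

Fact coind_actM F g h : coind_act F (g * h)%g = coind_act (coind_act F g) h.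
Proof. by apply/funext => x; rewrite /coind_act mulgA. Qed.

Fact coind_actD F F' g :
  coind_act (F + F') g = coind_act F g + coind_act F' g.
Proof. by []. Qed.

Definition coind : gmodule G (G -> V) := GModule coind_act1 coind_actM coind_actD.

Lemma coind_eval F g : coind F g 1%g = F g.
Proof. by rewrite /= /coind_act mulg1. Qed.

(** [H^3(G, G -> V) = 0], with the contraction [b g h k = - c g h k 1]: the
    cocycle identity, evaluated at [1], has [c g h k l] as its last term. *)
Lemma coind_H3 (c : G -> G -> G -> G -> V) :
    (forall g h k l, delta3 coind c g h k l = 0) ->
  exists b, forall g h k, c g h k = delta2 coind b g h k.
Proof.
move=> c0; exists (fun g h k => - c g h k 1%g) => g h k; apply/funext => l.
have := congr1 (fun F => F 1%g) (c0 g h k l).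
rewrite /delta3 /delta2 !fctE coind_eval /= /coind_act => /eqP.
by rewrite addrC addr_eq0 => /eqP ->; rewrite !opprK !opprD !opprK.
Qed.

(** [H^2(G, G -> V) = 0], by the same contraction one degree lower. *)
Lemma coind_H2 (b : G -> G -> G -> V) :
    (forall g h k, delta2 coind b g h k = 0) ->
  exists a, forall g h, b g h = a h - a (g * h)%g + coind (a g) h.
Proof.
move=> b0; exists (fun g h => b g h 1%g) => g h; apply/funext => k.
have := congr1 (fun F => F 1%g) (b0 g h k).
rewrite /delta2 !fctE coind_eval /= /coind_act => /eqP.
by rewrite subr_eq0 => /eqP ->.
Qed.

End Coinduced.

(** * Second cohomology of a cyclic group with trivial coefficients *)

Section CyclicH2.
Variables (G : finGroupType) (t : G) (V : zmodType).
Hypothesis t_gen : <[t]>%g = [set: G]%SET.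

Lemma cyclic_sum (f : G -> V) : \sum_g f g = \sum_(i < #[t]%g) f (t ^+ i)%g.
Proof.
pose F (i : 'I_#[t]%g) : G := (t ^+ i)%g.
rewrite (reindex F) //=; apply: onW_bij.
apply: inj_card_bij; last by rewrite card_ord -cardsT -t_gen.
move=> i j /eqP; rewrite eq_expg_mod_order !modn_small // => /eqP.
exact: val_inj.
Qed.

(** The map [b |-> \sum_g b g t] kills the coboundaries when [#|G|] kills
    [V]. *)
Lemma sum_coboundary (a : G -> V) :
  \sum_g (a t - a (g * t)%g + a g) = a t *+ #|G|.
Proof.
rewrite !big_split /= sumrN [X in _ + X](reindex_inj (mulIg t)) /=.
by rewrite subrK sumr_const.
Qed.

(** The map [b |-> \sum_g b g t] is injective on classes of 2-cocycles. *)
Lemma cyclic_H2 (b : G -> G -> V) :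
    (forall g h k, b h k - b (g * h)%g k + b g (h * k)%g - b g h = 0) ->
    \sum_g b g t = 0 ->
  exists a, forall g h, b g h = a h - a (g * h)%g + a g.
Proof.
move=> b2 bt.
(* The coboundary of [a] has to agree with [b] at [(g, t)].  With [a t = 0] this
   reads [a (g * t) = a g - b g t], which determines [a] along the powers of
   [t]; the start value [b 1 t] is what makes [a t] vanish.  The vanishing of
   the sum makes the recursion consistent after a full turn. *)
pose A i := b 1%g t - \sum_(j < i) b (t ^+ j)%g t.
have /choice[l lP] : forall g, exists i, (i < #[t]%g)%N /\ g = (t ^+ i)%g.
  by move=> g; have [i] := cyclic_index g t_gen; exists i.
pose a g := A (l g).
have aS g : a (g * t)%g = a g - b g t.
  have AS i : A i.+1 = A i - b (t ^+ i)%g t.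
    by rewrite /A big_ord_recr /= opprD addrA.
  have [lt_g gE] := lP g; have [lt_gt gtE] := lP (g * t)%g.
  rewrite /a {3}gE -AS; move: lt_g; rewrite leq_eqVlt => /orP[/eqP lgE|lt_g].
    have : l (g * t)%g = 0%N.
      apply/eqP; rewrite -(modn_small lt_gt) -[X in _ == X](mod0n #[t]%g).
      by rewrite -eq_expg_mod_order -gtE {1}gE -expgSr lgE expg_order.
    by move->; rewrite lgE /A -(cyclic_sum (b^~ t)) bt big_ord0.
  congr A; apply/eqP; rewrite -(modn_small lt_gt) -(modn_small lt_g).
  by rewrite -eq_expg_mod_order -gtE {1}gE -expgSr.
have at0 : a t = 0.
  rewrite -[t]mul1g aS; have [lt_1 E] := lP 1%g.
  suff -> : a 1%g = b 1%g t by rewrite subrr.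
  have -> : a 1%g = A 0%N.
    congr A; apply/eqP; rewrite -(modn_small lt_1) -[X in _ == X](mod0n #[t]%g).
    by rewrite -eq_expg_mod_order -E.
  by rewrite /A big_ord0 subr0.
move: a aS at0 => {A bt l lP} a aS at0; exists a => g h.
(* By the cocycle identity, [b] is determined by its values at the [(g, t)]. *)
have bS x y : b x (y * t)%g = b x y + b (x * y)%g t - b y t.
  have /eqP := b2 x y t; rewrite subr_eq0 => /eqP <-.
  by rewrite [RHS](ACl (3*(1*5)*(2*4))) /= addNr subrr !addr0.
have bE g1 : b g1 t = a g1 - a (g1 * t)%g by rewrite aS opprB addrC subrK.
have [i _] := cyclic_index (h * t^-1)%g t_gen; move/(canRL (mulgKV t)) => ->.
rewrite -expgSr; elim: i => [|i IHi]; first by rewrite expg1 at0 sub0r addrC bE.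
rewrite expgSr bS IHi !bE mulgA opprB !addrA.
by rewrite [LHS](ACl (6*5*3*(1*7)*(2*4))) /= addNr subrr !addr0.
Qed.
End CyclicH2.

(** * The connecting map from third to second cohomology *)

Section DimensionShift.
Variables (G : finGroupType) (t : G) (V A : zmodType) (act : gmodule G A).
Hypothesis t_gen : <[t]>%g = [set: G]%SET.
Hypothesis V_exp : forall v : V, v *+ #|G| = 0.
Variable j : A -> G -> V.
(* [j] identifies [A] with the kernel of the summation map [(G -> V) -> V]. *)
Hypothesis jD : forall a b, j (a + b) = j a + j b.
Hypothesis j_inj : injective j.
Hypothesis j_act : forall a g, j (act a g) = coind G V (j a) g.
Hypothesis j_exact : forall F : G -> V, \sum_x F x = 0 <-> exists a, F = j a.

Implicit Types (c : G -> G -> G -> A) (v : V).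

(** The composite [H^3(G, A) -> H^2(G, V) -> V] of the inverse of the connecting
    map with [b |-> \sum_g b g t], as a relation between 3-cochains of [A] and
    elements of [V], since the primitive [b] in [G -> V] is not unique. *)
Definition connects c v : Prop := exists b : G -> G -> (G -> V),
  (forall g h k, j (c g h k) = delta2 (coind G V) b g h k) /\
  \sum_g \sum_x b g t x = v.

Lemma ker_map0 : j 0 = 0.
Proof. by apply: (addrI (j 0)); rewrite -jD !addr0. Qed.

Lemma ker_mapN a : j (- a) = - j a.
Proof. by apply: (addrI (j a)); rewrite -jD !subrr ker_map0. Qed.

Lemma ker_map_delta2 (b : G -> G -> A) g h k :
  j (delta2 act b g h k) = delta2 (coind G V) (fun x y => j (b x y)) g h k.
Proof. by rewrite /delta2 !jD !ker_mapN j_act. Qed.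

Lemma ker_map_delta3 c g h k l :
  j (delta3 act c g h k l) =
  delta3 (coind G V) (fun x y z => j (c x y z)) g h k l.
Proof. by rewrite /delta3 !jD !ker_mapN j_act. Qed.

Lemma sum_coind (F : G -> V) g : \sum_x coind G V F g x = \sum_x F x.
Proof. by rewrite [RHS](reindex_inj (mulgI g)). Qed.

Lemma sum_fct (F F' : G -> V) : \sum_x (F + F') x = \sum_x F x + \sum_x F' x.
Proof. exact: big_split. Qed.

Lemma sum_fctN (F : G -> V) : \sum_x (- F) x = - \sum_x F x.
Proof. exact: sumrN. Qed.

Lemma sum_delta2 (b : G -> G -> G -> V) g h k :
  \sum_x delta2 (coind G V) b g h k x =
  (\sum_x b h k x - \sum_x b (g * h)%g k x + \sum_x b g (h * k)%g x)
    - \sum_x b g h x.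
Proof. by rewrite /delta2 !(sum_fct, sum_fctN) sum_coind. Qed.

(** The next lemmas say that the relation is everywhere defined on cocycles,
    additive, and well defined and injective on classes. *)
Lemma connects_total c : c \in cocycle3 act -> exists v, connects c v.
Proof.
move=> /asboolP c3.
have [g h k l|b bE] := @coind_H3 G V (fun x y z => j (c x y z)).
  by rewrite -ker_map_delta3 c3 ker_map0.
by exists (\sum_g \sum_x b g t x), b.
Qed.

Lemma connectsB c c' v v' : connects c v -> connects c' v' -> connects (c - c') (v - v').
Proof.
move=> [b [bE <-]] [b' [b'E <-]]; exists (b - b'); split=> [g h k|].
  by rewrite delta2B -bE -b'E !fctE jD ker_mapN.
by rewrite -sumrB; apply: eq_bigr => g _; rewrite -sumrB.
Qed.

Lemma connects_coboundary c v (b : G -> G -> A) : connects c v ->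
  (forall g h k, c g h k = delta2 act b g h k) -> v = 0.
Proof.
move=> [r [rE <-]] cE.
have [g h k|a aE] := @coind_H2 G V (r - (fun x y => j (b x y))).
  by rewrite delta2B -rE -ker_map_delta2 cE subrr.
rewrite -[RHS](V_exp (\sum_x a t x)) -(sum_coboundary t (fun g => \sum_x a g x)).
apply: eq_bigr => g _.
have /(congr1 (fun F : G -> V => \sum_x F x)) := aE g t.
rewrite !(sum_fct, sum_fctN) sum_coind => <-.
by have /j_exact -> : exists a, j (b g t) = j a; [exists (b g t) | rewrite subr0].
Qed.

Lemma connects0_coboundary c : connects c 0 ->
  exists b : G -> G -> A, forall g h k, c g h k = delta2 act b g h k.
Proof.
move=> [r [rE r0]].
have [g h k|f fE] := @cyclic_H2 G t V t_gen (fun g h => \sum_x r g h x) _ r0.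
  rewrite -sum_delta2 -rE; apply/j_exact; by exists (c g h k).
(* [f] is lifted to a 1-cochain [F] of [G -> V], and [r] is corrected by the
   coboundary [r'] of [F] so as to take values in the image of [A]. *)
pose F g : G -> V := fun x => if x == 1%g then f g else 0.
have sumF g : \sum_x F g x = f g.
  by rewrite (bigD1 1%g) //= /F eqxx big1 ?addr0 // => x /negPf ->.
pose r' : G -> G -> G -> V := fun g h => F h - F (g * h)%g + coind G V (F g) h.
have /choice[b bE] : forall x : G * G, exists a, r x.1 x.2 - r' x.1 x.2 = j a.
  case=> g h; apply/j_exact.
  by rewrite !(sum_fct, sum_fctN) sum_coind !sumF fE subrr.
have r'0 g h k : delta2 (coind G V) r' g h k = 0.
  rewrite /delta2 /r' !gactD gactN Defs.gactM mulgA !opprD !opprK !addrA.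
  rewrite [LHS](ACl ((1*4)*(7*2)*(3*10)*(5*8)*(11*6)*(9*12))) /=.
  by rewrite !subrr !addr0.
exists (fun g h => b (g, h)) => g h k; apply: j_inj.
rewrite rE ker_map_delta2.
have -> : (fun x y => j (b (x, y))) = r - r'.
  by apply/funext => x; apply/funext => y; rewrite -bE.
by rewrite delta2B r'0 subr0.
Qed.

Lemma connectsBMn c c' v v' k :
  connects c v -> connects c' v' -> connects (c - c' *+ k) (v - v' *+ k).
Proof.
move=> cv c'v'; elim: k => [|k IHk]; first by rewrite !mulr0n !subr0.
by rewrite !mulrSr !opprD !addrA; apply: connectsB.
Qed.

Lemma H3_class_eq0 (c : Z3 act) : H3_class c = 0 <->
  exists b, forall g h k, val c g h k = delta2 act b g h k.
Proof.
rewrite /H3_class -(raddf0 (\pi_(Quotient.quot (@coboundary3 _ _ act))%qT)).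
split=> [/eqP|cb].
  by rewrite -Quotient.idealrBE subr0 => /asboolP.
by apply/eqP; rewrite -Quotient.idealrBE subr0; apply/asboolP.
Qed.

Lemma H3_classBMn (c d : Z3 act) k :
  H3_class (c - d *+ k) = H3_class c - H3_class d *+ k.
Proof. by rewrite /H3_class raddfB raddfMn. Qed.

Lemma H3_surj (y : H3 act) : exists d : Z3 act, y = H3_class d.
Proof. by exists (generic_quotient.repr y); rewrite /H3_class reprK. Qed.

Lemma val_Z3BMn (c d : Z3 act) k : val (c - d *+ k) = val c - val d *+ k.
Proof. by rewrite raddfB raddfMn. Qed.

Lemma H3_connects_generator (x : Z3 act) v : connects (val x) v ->
  (forall w, exists k, w = v *+ k) -> forall y, exists k, y = H3_class x *+ k.
Proof.
move=> xv v_gen y; have [c ->] := H3_surj y.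
have [w cw] := connects_total (valP c); have [k wE] := v_gen w.
exists k; apply/eqP; rewrite -subr_eq0 -H3_classBMn; apply/eqP/H3_class_eq0.
rewrite val_Z3BMn; apply: connects0_coboundary.
by rewrite -(subrr w) {2}wE; apply: connectsBMn.
Qed.

(** The cocycle [- x *+ k] is written [x - x - x *+ k] so that [connectsBMn]
    applies to it. *)
Lemma H3_classNMn (x : Z3 act) k :
  H3_class (x - x - x *+ k) = - (H3_class x *+ k).
Proof. by rewrite H3_classBMn subrr /H3_class raddf0 sub0r. Qed.

Lemma H3_connects_order (x : Z3 act) v k : connects (val x) v ->
  H3_class x *+ k = 0 <-> v *+ k = 0.
Proof.
move=> xv; have xv0 : connects (val (x - x - x *+ k)) (v - v - v *+ k).
  by rewrite val_Z3BMn raddfB; apply: connectsBMn => //; apply: connectsB.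
split=> [xk0|vk0]; apply/oppr_inj; rewrite oppr0.
  have /H3_class_eq0[b bE] : H3_class (x - x - x *+ k) = 0.
    by rewrite H3_classNMn xk0 oppr0.
  by rewrite -sub0r -[X in X - _](subrr v); exact: connects_coboundary xv0 bE.
rewrite -H3_classNMn; apply/H3_class_eq0; apply: connects0_coboundary.
by move: xv0; rewrite vk0 subrr subr0.
Qed.

End DimensionShift.

(** * The group of functions as a crossed module *)

Section PowerGroup.
Variables (X : Type) (H : groupType).

(** All functions from [X] to [H], with pointwise multiplication. *)
Definition power_group : Type := X -> H.
HB.instance Definition _ := Choice.copy power_group (X -> H).

Implicit Types F : power_group.

Definition pg_one : power_group := fun=> 1%g.
Definition pg_inv F : power_group := fun x => (F x)^-1%g.
Definition pg_mul F F' : power_group := fun x => (F x * F' x)%g.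

Fact pg_mulA : associative pg_mul.
Proof. by move=> F F' F''; apply/funext => x; apply: mulgA. Qed.
Fact pg_1mul : left_id pg_one pg_mul.
Proof. by move=> F; apply/funext => x; apply: mul1g. Qed.
Fact pg_mul1 : right_id pg_one pg_mul.
Proof. by move=> F; apply/funext => x; apply: mulg1. Qed.
Fact pg_Vmul : left_inverse pg_one pg_inv pg_mul.
Proof. by move=> F; apply/funext => x; apply: mulVg. Qed.
Fact pg_mulV : right_inverse pg_one pg_inv pg_mul.
Proof. by move=> F; apply/funext => x; apply: mulgV. Qed.
HB.instance Definition _ :=
  isGroup.Build power_group pg_mulA pg_1mul pg_mul1 pg_Vmul pg_mulV.

Lemma pgM F F' x : (F * F')%g x = (F x * F' x)%g. Proof. by []. Qed.
End PowerGroup.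

Section PowerXmod.
Variables (G : finGroupType) (P Q : groupType).
Hypothesis PC : forall x y : P, (x * y = y * x)%g.
Hypothesis QC : forall x y : Q, (x * y = y * x)%g.
Variables (iota : {multiplicative P -> Q}) (phi : {multiplicative Q -> G}).
Hypothesis phi_iota : forall p, phi (iota p) = 1%g.

Local Notation M0 := (power_group G P).

(** The product of all values of a function. *)
Definition power_prod (F : M0) : P := \sum_(x : G) (F x : additive_of PC).

Lemma power_prodM F F' : power_prod (F * F')%g = (power_prod F * power_prod F')%g.
Proof. exact: (@big_split (additive_of PC)). Qed.

Definition power_map (F : M0) : Q := iota (power_prod F).

Fact power_map_multiplicative (F F' : M0) :
  power_map (F * F')%g = (power_map F * power_map F')%g.
Proof. by rewrite /power_map power_prodM gmulfM. Qed.
HB.instance Definition _ :=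
  isMultiplicative.Build M0 Q power_map power_map_multiplicative.

Definition power_act (F : M0) (q : Q) : M0 := fun x => F (phi q * x)%g.

Lemma power_act1 F : power_act F 1%g = F.
Proof. by apply/funext => x; rewrite /power_act mulhom1 mul1g. Qed.
Lemma power_actM F p q : power_act F (p * q)%g = power_act (power_act F p) q.
Proof. by apply/funext => x; rewrite /power_act gmulfM mulgA. Qed.
Lemma power_actMg F F' p :
  power_act (F * F')%g p = (power_act F p * power_act F' p)%g.
Proof. by []. Qed.
Lemma conj_comm (x y : Q) : (y^-1 * x * y)%g = x.
Proof. by rewrite -mulgA (QC x) mulKg. Qed.
Lemma power_prod_act F q : power_prod (power_act F q) = power_prod F.
Proof. by rewrite /power_prod [RHS](reindex_inj (mulgI (phi q))). Qed.
Lemma power_map_act F q : power_map (power_act F q) = (q^-1 * power_map F * q)%g.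
Proof. by rewrite conj_comm /power_map power_prod_act. Qed.
Lemma power_peiffer (F F' : M0) :
  (F'^-1 * F * F')%g = power_act F (power_map F').
Proof.
apply/funext => x; rewrite /power_act phi_iota mul1g !pgM -mulgA (PC (F x)).
exact: mulKg.
Qed.

(** The crossed [Q]-module of functions [G -> P]: the boundary is the product of
    the values, mapped to [Q], and [Q] acts by translation through [phi]. *)
Definition power_xmod : crossed_module M0 Q :=
  @CrossedModule M0 Q power_map power_act power_act1 power_actM power_actMg
    power_map_act power_peiffer.

(** The copy of [P] at the coordinate [1]; this is the structure map of
    [power_xmod] as an induced crossed module. *)
Definition delta_fun (p : P) : M0 := fun x => if x == 1%g then p else 1%g.

Lemma delta_fun_multiplicative p q :
  delta_fun (p * q)%g = (delta_fun p * delta_fun q)%g.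
Proof.
by apply/funext => x; rewrite pgM /delta_fun; case: ifP; rewrite ?mulg1.
Qed.
HB.instance Definition _ :=
  isMultiplicative.Build P M0 delta_fun delta_fun_multiplicative.

Lemma power_prod_delta p : power_prod (delta_fun p) = p.
Proof.
rewrite /power_prod (bigD1 1%g) //= big1 => [|x /negPf x1]; last first.
  by rewrite /delta_fun x1.
by rewrite addr0 /delta_fun eqxx.
Qed.

Lemma delta_fun_morphism : xmod_morphism (xmod_id P) power_xmod delta_fun iota.
Proof.
split=> [p|p q] /=; first by rewrite /power_map power_prod_delta.
apply/funext => x; rewrite /power_act phi_iota mul1g.
by rewrite conjgE PC mulgK.
Qed.

End PowerXmod.

(** * The induced crossed module is the module of functions *)

Section Induced.
Variables (G : finGroupType) (P Q : groupType).
Hypothesis PC : forall x y : P, (x * y = y * x)%g.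
Hypothesis QC : forall x y : Q, (x * y = y * x)%g.
Variables (iota : {multiplicative P -> Q}) (phi : {multiplicative Q -> G}).
Hypothesis phi_surj : forall x, exists q, phi q = x.
Hypothesis phi_exact : forall q, phi q = 1%g <-> exists p, q = iota p.
Variables (N : groupType) (d : crossed_module N Q).
Variable ibar : {multiplicative P -> N}.
Hypothesis d_induced : is_induced (xmod_id P) iota d ibar.

Local Notation M0 := (power_group G P).

Lemma phi_iota p : phi (iota p) = 1%g.
Proof. by apply/phi_exact; exists p. Qed.

Local Notation d0 := (power_xmod PC QC phi_iota).

(** Uniqueness in the universal property, between two given morphisms. *)
Lemma induced_ext (C : groupType) (gamma : crossed_module C Q)
    (g g' : {multiplicative N -> C}) :
  xmod_morphism d gamma g idfun -> xmod_morphism d gamma g' idfun ->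
  (forall p, g (ibar p) = g' (ibar p)) -> g =1 g'.
Proof.
move=> gX g'X gg'; have [[dibar dact] univ] := d_induced.
have [|h [hX hE hU]] := univ C gamma (g \o ibar).
  case: gX => gd ga; split=> [p|p q] /=; first by rewrite gd dibar.
  by rewrite -ga -dact.
by move=> m; rewrite (hU g) // (hU g') // => p; rewrite -gg'.
Qed.

(** Acting by [iota p] is an endomorphism of the crossed [Q]-module [N], as [Q]
    is commutative, and it fixes the image of [ibar], as [P] is; so it is the
    identity. *)
Lemma induced_iota_act m p : xact d m (iota p) = m.
Proof.
pose f (m : N) := xact d m (iota p).
have fM : forall m n, f (m * n)%g = (f m * f n)%g by move=> *; exact: xactMg.
pose fm : {multiplicative N -> N} :=
  HB.pack f (isMultiplicative.Build N N f fM).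
have [[dibar dact] _] := d_induced.
apply: (@induced_ext _ d fm idfun) m => //.
  split=> [m|m q] /=; first by rewrite xmap_act conj_comm.
  by rewrite /f -!xactM QC.
move=> q /=; rewrite /f -dact /=.
by rewrite conjgE PC mulgK.
Qed.

Lemma induced_map : exists g : {multiplicative N -> M0},
  xmod_morphism d d0 g idfun /\ forall p, g (ibar p) = delta_fun p.
Proof.
have [_ univ] := d_induced.
have [g [gX gE _]] := univ _ d0 _ (delta_fun_morphism PC QC phi_iota).
by exists g.
Qed.

(** The boundary takes its values in [iota P], which acts trivially; so [N] is
    commutative by the Peiffer identity. *)
Lemma induced_comm (m n : N) : (m * n = n * m)%g.
Proof.
have [g [[gd _] _]] := induced_map.
by rewrite (xpeifferC d) -[d n]/(idfun (d n)) -gd /= induced_iota_act.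
Qed.

(** A set-theoretic section of [phi]. *)
Definition phi_lift x : Q := sval (cid (phi_surj x)).

Lemma phi_liftK x : phi (phi_lift x) = x.
Proof. exact: svalP (cid (phi_surj x)). Qed.

Lemma induced_act_phi m q q' : phi q = phi q' -> xact d m q = xact d m q'.
Proof.
move=> qq'; have /phi_exact[p pE] : phi (q' * q^-1)%g = 1%g.
  by rewrite gmulfM mulhomV qq' mulgV.
by rewrite -(mulgVK q q') pE xactM induced_iota_act.
Qed.

Lemma xact_sum (I : Type) (r : seq I) (F : I -> additive_of induced_comm) q :
  xact d (\sum_(i <- r) F i) q
  = \sum_(i <- r) (xact d (F i) q : additive_of induced_comm).
Proof.
elim: r => [|i r IHr]; first by rewrite !big_nil; exact: xact1g.
by rewrite !big_cons -IHr; exact: xactMg.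
Qed.

(** The map from the functions to [N]: a function is the product over [x] of the
    translates by [x^-1] of its value at [x], placed at the coordinate [1]. *)
Definition power_lift (F : M0) : N :=
  \sum_(x : G)
    (xact d (ibar (F x)) (phi_lift x)^-1%g : additive_of induced_comm).

Lemma power_liftM F F' : power_lift (F * F')%g = (power_lift F * power_lift F')%g.
Proof.
rewrite -[RHS](@big_split (additive_of induced_comm)) /power_lift.
by apply: eq_bigr => x _; rewrite pgM gmulfM xactMg.
Qed.
HB.instance Definition _ := isMultiplicative.Build M0 N power_lift power_liftM.

Lemma power_lift_morphism : xmod_morphism d0 d power_lift idfun.
Proof.
have [[dibar _] _] := d_induced.
split=> [F|F q] /=.
  rewrite /power_lift (mulhom_sum QC) /power_map /power_prod (mulhom_sum QC).
  by apply: eq_bigr => x _; rewrite xmap_act (conj_comm QC); exact: dibar.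
rewrite /power_lift xact_sum [RHS](reindex_inj (mulgI (phi q))).
apply: eq_bigr => x _; rewrite -xactM /power_act.
apply: induced_act_phi.
by rewrite gmulfM !mulhomV !phi_liftK invgM mulgVK.
Qed.

Lemma power_lift_delta p : power_lift (delta_fun p) = ibar p.
Proof.
rewrite /power_lift (bigD1 1%g) //= big1 => [|x /negPf x1]; last first.
  by rewrite /delta_fun x1 mulhom1; exact: xact1g.
rewrite addr0 /delta_fun eqxx -[RHS](xact1 d).
by apply: induced_act_phi; rewrite mulhomV phi_liftK mulhom1 invg1.
Qed.

Theorem induced_iso : exists g : {multiplicative N -> M0},
  bijective g /\ xmod_morphism d d0 g idfun.
Proof.
have [g [gX gE]] := induced_map; exists g; split=> //.
exists (power_lift : M0 -> N).
  apply: (@induced_ext _ d (power_lift \o g) idfun) => //=.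
    case: gX => gd ga; have [sd sa] := power_lift_morphism.
    by split=> [m|m q] /=; [rewrite sd gd | rewrite ga sa].
  by move=> p; rewrite gE power_lift_delta.
move=> F; apply/funext => y.
have evM m n : g (m * n)%g y = (g m y * g n y)%g by rewrite gmulfM.
pose ev : {multiplicative N -> P} :=
  HB.pack (fun m => g m y) (isMultiplicative.Build N P (fun m => g m y) evM).
rewrite -[LHS]/(ev (power_lift F)) /power_lift (mulhom_sum PC) (bigD1 y) //=.
have gact m q : g (xact d m q) y = g m (phi q * y)%g by rewrite gX.2.
rewrite big1 => [|x xy].
  by rewrite addr0 gact gE mulhomV phi_liftK mulVg /delta_fun eqxx.
rewrite gact gE mulhomV phi_liftK /delta_fun.
by rewrite -eq_mulVg1 (negPf xy).
Qed.
End Induced.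

(** * The kernel and the class of the induced crossed module *)

Section Kernel.
Variables (G : finGroupType) (P Q N : groupType).
Hypothesis PC : forall x y : P, (x * y = y * x)%g.
Hypothesis QC : forall x y : Q, (x * y = y * x)%g.
Variables (iota : {multiplicative P -> Q}) (phi : {multiplicative Q -> G}).
Hypothesis phi_iota : forall p, phi (iota p) = 1%g.
Hypothesis iota_inj : injective iota.
Variables (d : crossed_module N Q) (phi_coker : is_coker d phi).
Variable gN : {multiplicative N -> power_group G P}.
Hypothesis gN_bij : bijective gN.
Hypothesis gN_morphism : xmod_morphism d (power_xmod PC QC phi_iota) gN idfun.

Local Notation V := (additive_of PC).

(** The kernel of [d] inside the coinduced module [G -> V]. *)
Definition ker_in (a : xker d) : G -> V := gN (val a).

Lemma ker_inD a b : ker_in (a + b) = ker_in a + ker_in b.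
Proof. by rewrite /ker_in /= gmulfM. Qed.

Lemma ker_in_inj : injective ker_in.
Proof. by move=> a b /(bij_inj gN_bij) /val_inj. Qed.

Lemma ker_in_act a g :
  ker_in (xker_module phi_coker a g) = coind G V (ker_in a) g.
Proof.
have [q <-] := phi_coker.1 g.
by rewrite /ker_in xker_gact_val gN_morphism.2.
Qed.

Lemma xmod_power_prod m : d m = iota (power_prod PC (gN m)).
Proof. by rewrite -[LHS]gN_morphism.1. Qed.

Lemma ker_in_exact (F : G -> V) :
  \sum_x F x = 0 <-> exists a, F = ker_in a.
Proof.
split=> [F0|[a ->]].
  have [hN _ hNK] := gN_bij.
  have /eqP m1 : d (hN F) = 1%g.
    by rewrite xmod_power_prod hNK /power_prod F0; exact: mulhom1.
  by exists (exist _ (hN F) m1 : xker d); rewrite /ker_in /= hNK.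
by apply: iota_inj; rewrite -xmod_power_prod xkerP mulhom1.
Qed.

(** The cocycle of a factor system [s], [f] is the coboundary of [f], and the
    boundaries of the [f g t] multiply to [s t ^+ #|G|]. *)
Lemma factor_system_connects (t : G) (s : G -> Q) (f : G -> G -> N)
    (c : G -> G -> G -> xker d) (v : P) :
    @factor_system G (xker d) (xker_module phi_coker)
      (xker_sequence phi_coker) s f c ->
    iota v = (s t ^+ #|G|)%g ->
  connects t ker_in c (v : V).
Proof.
case=> /= sK fE cE vE.
pose b g h : G -> V := gN (f g h).
exists b; split=> [g h k|].
  have : b g (h * k)%g + b h k =
         b (g * h)%g k + coind G V (b g h) k + ker_in (c g h k).
    rewrite -[LHS]/(gN (f g (h * k)) * gN (f h k))%g -gmulfM cE !gmulfM.
    rewrite gN_morphism.2.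
    suff -> : xact (power_xmod PC QC phi_iota) (gN (f g h)) (idfun (s k))
              = coind_act (b g h) k by [].
    by rewrite /= /power_act sK.
  move/(canLR (addKr _)) <-.
  by rewrite /delta2 opprD !addrA [LHS](ACl (4*1*3*2)).
pose sA g : additive_of QC := s g.
have fdE g : (d (f g t) : additive_of QC) = sA t - sA (g * t)%g + sA g.
  have : sA g + sA t = sA (g * t)%g + (d (f g t) : additive_of QC) by exact: fE.
  by move/(canLR (addKr _)) <-; rewrite addrA [LHS](ACl (3*1*2)).
apply: iota_inj; rewrite vE.
rewrite [LHS](mulhom_sum QC) -(additive_ofMn (sA t)) -(sum_coboundary t sA).
by apply: eq_bigr => g _; rewrite -fdE xmod_power_prod.
Qed.
End Kernel.

Theorem theorem5p4 (n : nat) (n_ge2 : (2 <= n)%N)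
    (* [P] is C_n with generator [t], [Q] is C_(n^2) with generator [u] *)
    (P Q : finGroupType) (t : P) (u : Q)
    (t_gen : <[t]>%g = [set: P]%SET) (t_order : #[t]%g = n)
    (u_gen : <[u]>%g = [set: Q]%SET) (u_order : #[u]%g = (n ^ 2)%N)
    (iota : {multiplicative P -> Q}) (iota_t : iota t = (u ^+ n)%g)
    (* [d : N -> Q] is the crossed module induced by [iota] *)
    (N : groupType) (d : crossed_module N Q) (ibar : {multiplicative P -> N})
    (d_induced : is_induced (xmod_id P) iota d ibar)
    (* the identification of the cokernel of [d] with C_n *)
    (phi : {multiplicative Q -> P}) (phi_u : phi u = t) :
  exists phi_coker : is_coker d phi,
    [/\ zmod_cyclic (H3 (xker_module phi_coker)),
        ([set: H3 (xker_module phi_coker)]%classic #= `I_n)%card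
      & zmod_generator (crossed_class (xker_sequence phi_coker))].
Proof.
have n_gt0 : (0 < n)%N by apply: ltnW.
have PC := cyclic_comm t_gen; have QC := cyclic_comm u_gen.
have cardP : #|P| = n by rewrite -cardsT -t_gen.
have iotaX i : iota (t ^+ i)%g = (u ^+ (n * i))%g.
  by rewrite expgM -iota_t mulhomX.
have phiX i : phi (u ^+ i)%g = (t ^+ i)%g.
  by rewrite -phi_u mulhomX.
have iota_inj : injective iota.
  move=> p q; have [i ltin ->] := cyclic_index p t_gen.
  have [j ltjn ->] := cyclic_index q t_gen.
  rewrite !iotaX => /eqP; rewrite eq_expg_mod_order u_order expnS expn1.
  rewrite -!muln_modr eqn_pmul2l // => /eqP ij; apply/eqP.
  by rewrite eq_expg_mod_order t_order ij.
have phi_surj p : exists q, phi q = p.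
  by have [i _ ->] := cyclic_index p t_gen; exists (u ^+ i)%g.
have phi_exact q : phi q = 1%g <-> exists p, q = iota p.
  split=> [|[p ->]].
    have [i _ ->] := cyclic_index q u_gen; rewrite phiX => /eqP.
    rewrite -order_dvdn t_order => /dvdnP[k ->].
    by exists (t ^+ k)%g; rewrite iotaX mulnC.
  have [i _ ->] := cyclic_index p t_gen; rewrite iotaX phiX.
  by rewrite expgM -t_order expg_order expg1n.
have [g [g_bij gX]] := induced_iso PC QC phi_surj phi_exact d_induced.
have coker : is_coker d phi.
  split=> // q; split=> [/phi_exact[p ->]|[m ->]].
    by exists (ibar p); rewrite d_induced.1.1.
  apply/phi_exact; exists (power_prod PC (g m)); exact: (xmod_power_prod gX).
exists coker.
have V_exp (v : additive_of PC) : v *+ #|P| = 0.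
  have [i _ vE] := cyclic_index v t_gen.
  rewrite additive_ofMn vE -expgM mulnC expgM.
  by rewrite cardP -t_order expg_order expg1n.
set act := xker_module coker; set E := xker_sequence coker.
set x := Sub (cs_cocycle E) (factor_system_cocycle (cs_factor_systemP E)) : Z3 act.
have xt : connects t (@ker_in P P Q N PC d g) (val x) (t : additive_of PC).
  apply: (factor_system_connects iota_inj gX (cs_factor_systemP E)).
  (* Two lifts of [t] differ by an element of [iota P], which [n] kills. *)
  have [p pE] : exists p, cs_section E t = (u * iota p)%g.
    have /phi_exact[p pE] : phi (u^-1 * cs_section E t)%g = 1%g.
      by rewrite gmulfM mulhomV phi_u (cs_sectionK E) mulVg.
    by exists p; rewrite -pE mulVKg.
  rewrite pE expgMn; last exact: QC.
  rewrite cardP iota_t; have [i _ ->] := cyclic_index p t_gen.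
  by rewrite iotaX -expgM mulnAC mulnn expgM -u_order expg_order expg1n mulg1.
have t_span (w : additive_of PC) : exists k, w = (t : additive_of PC) *+ k.
  have [i _ wE] := cyclic_index w t_gen.
  by exists i; rewrite additive_ofMn.
have x_gen := H3_connects_generator t_gen (@ker_inD P P Q N PC d g)
  (@ker_in_inj P P Q N PC d g g_bij) (ker_in_act coker gX)
  (ker_in_exact iota_inj g_bij gX) xt t_span.
have x_order k : H3_class x *+ k = 0 <-> (n %| k)%N.
  have xk := H3_connects_order t_gen V_exp (@ker_inD P P Q N PC d g)
    (@ker_in_inj P P Q N PC d g g_bij) (ker_in_act coker gX)
    (ker_in_exact iota_inj g_bij gX) k xt.
  split=> [/xk|nk]; first by rewrite additive_ofMn -t_order order_dvdn => /eqP.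
  by apply/xk; rewrite additive_ofMn; apply/eqP; rewrite -order_dvdn t_order.
have x_zgen : zmod_generator (H3_class x).
  by move=> y; have [k ->] := x_gen y; exists k%:Z.
split; [by exists (H3_class x) | | exact: x_zgen].
exact: cyclic_card_eq n_gt0 x_gen x_order.
Qed.
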